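(* Let $X,Y\subset\mathbb{R}^d$ be compact and let $c:X\times Y\to\mathbb{R}$ satisfy: (C1) $c\in\mathcal{C}^2(X\times Y)$; (C2) for any $x\in X$, the map $Y\ni y\mapsto-\nabla_xc(x,y)$ is one-to-one; (C3) for any $y\in Y$, the map $X\ni x\mapsto-\nabla_yc(x,y)$ is one-to-one; (C4) $\det\nabla_{xy}c(x,y)\neq0$ for all $(x,y)\in X\times Y$. Let $\pi\in\Pi(\mu,\nu)$ be a coupling with $c$-monotone support ($\operatorname{Spt}\pi\subseteq X\times Y$). There exist $\epsilon>0$ and $C<\infty$ depending only on $d$ such that for all $\Lambda<\infty$ and all $R>0$ (with $\mathbb{B}_{5R,\Lambda R}\subseteq X\times Y$) such that $$\#_{5R}\cap\operatorname{Spt}\pi\subseteq\mathbb{B}_{5R,\Lambda R}$$ and for which $$\mathcal{E}_{6R}(\pi)+\mathcal{D}_{6R}(\mu,\nu)\le\epsilon\quad\text{and}\quad\|\nabla_{xy}c+\mathbb{I}\|_{\mathcal{C}^0(\mathbb{B}_{5R,\Lambda R})}\le\epsilon,$$ we have $$(x,y)\in\#_{4R}\cap\operatorname{Spt}\pi\quad\Rightarrow\quad|x-y|\le CR\left(\mathcal{E}_{6R}(\pi)+\mathcal{D}_{6R}(\mu,\nu)\right)^{\frac1{d+2}}.$$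
   Context: $\mu,\nu$ are measures on $\mathbb{R}^d$ and $\Pi(\mu,\nu)$ is the set of their couplings. $B_R$ is the ball of radius $R$ centered at $0$. The support of $\pi$ is $c$-monotone if $c(x,y)+c(x',y')\le c(x,y')+c(x',y)$ for all $(x,y),(x',y')\in\operatorname{Spt}\pi$. $\nabla_{xy}c$ is the matrix of mixed second derivatives; $\mathbb{I}$ is the identity matrix. $\#_R:=(B_R\times\mathbb{R}^d)\cup(\mathbb{R}^d\times B_R)$; $\mathbb{B}_{r,s}:=(B_r\times B_s)\cup(B_s\times B_r)$. $\mathcal{E}_R(\pi):=\frac1{R^{d+2}}\int_{\#_R}\frac12|x-y|^2\,d\pi$, and $$\mathcal{D}_R(\mu,\nu):=\frac1{R^{d+2}}W^2_{B_R}(\mu,\kappa_\mu)+\frac{(\kappa_\mu-1)^2}{\kappa_\mu}+\frac1{R^{d+2}}W^2_{B_R}(\nu,\kappa_\nu)+\frac{(\kappa_\nu-1)^2}{\kappa_\nu},$$ where $\kappa_\mu=\mu(B_R)/|B_R|$ (similarly $\kappa_\nu$), $W^2_{B_R}(\mu,\kappa_\mu)=W^2(\mu\lfloor_{B_R},\kappa_\mu\,dx\lfloor_{B_R})$ and $W^2(\mu,\nu)=\inf_{\pi\in\Pi(\mu,\nu)}\int\frac12|x-y|^2\,d\pi$. *)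

(* Defs.v *)
From HB Require Import structures.
From mathcomp Require Import all_boot all_order all_algebra.
From mathcomp Require Import all_classical all_reals all_analysis.
Set Implicit Arguments.
Unset Strict Implicit.
Unset Printing Implicit Defensive.
Import Order.TTheory GRing.Theory Num.Theory.
Import numFieldNormedType.Exports.

Local Open Scope classical_set_scope.
Local Open Scope ring_scope.

Section borel_matrix.
Context {R : realType} {m n : nat}.

HB.instance Definition _ :=
  @isMeasurable.Build (sigma_display (@open 'M[R]_(m, n))) 'M[R]_(m, n)
    (<<s @open 'M[R]_(m, n) >>)
    (@sigma_algebra0 _ setT _) (@sigma_algebraC _ _)
    (@sigma_algebra_bigcup _ setT _).

End borel_matrix.

(* The n-dimensional Lebesgue measure is not in the library: it is built on
   n.-tuple R as an iterated product, then transported to row vectors. *)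
Section tuple_lebesgue_step.
Context {R : realType} {n : nat}.
Variable m : {sigma_finite_measure set (n.-tuple R) -> \bar R}.

Definition tuple_cons (p : R * n.-tuple R) : n.+1.-tuple R :=
  [tuple of p.1 :: p.2].

Lemma measurable_tuple_cons : measurable_fun [set: R * n.-tuple R] tuple_cons.
Proof. exact: (measurable_cons measurable_fst measurable_snd). Qed.

Definition cons_measure : set (n.+1.-tuple R) -> \bar R :=
  pushforward (@lebesgue_measure R \x m)%E tuple_cons.

Let cons_measure0 : cons_measure set0 = 0%E.
Proof. by rewrite /cons_measure /pushforward preimage_set0 measure0. Qed.

Let cons_measure_ge0 A : (0 <= cons_measure A)%E.
Proof. by rewrite /cons_measure /pushforward measure_ge0. Qed.

Let cons_measure_sigma_additive : semi_sigma_additive cons_measure.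
Proof.
exact: (@measure_semi_sigma_additive _ _ _
  (measure_function_pushforward__canonical__measure_function_Measure
     (@lebesgue_measure R \x m)%E measurable_tuple_cons)).
Qed.

HB.instance Definition _ := isMeasure.Build _ _ _ cons_measure
  cons_measure0 cons_measure_ge0 cons_measure_sigma_additive.

Let cons_measure_sigma_finite : sigma_finite [set: n.+1.-tuple R] cons_measure.
Proof.
have /sigma_finiteP[F [FT ndF Foo]] := sigma_finiteT (@lebesgue_measure R).
have /sigma_finiteP[G [GT ndG Goo]] := sigma_finiteT m.
exists (fun k => [set t | F k (thead t) /\ G k [tuple of behead t]]).
  apply/seteqP; split=> // t _.
  have [i _ Fi] : (\bigcup_i F i) (thead t) by rewrite -FT.
  have [j _ Gj] : (\bigcup_j G j) [tuple of behead t] by rewrite -GT.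
  exists (maxn i j) => //; split.
    by move: Fi; apply/subsetPset/ndF/leq_maxl.
  by move: Gj; apply/subsetPset/ndG/leq_maxr.
move=> k; have [mF Fk] := Foo k; have [mG Gk] := Goo k; split.
  rewrite -[X in measurable X]setTI.
  rewrite -[X in _ `&` X]/((fun t => (thead t, [tuple of behead t])) @^-1`
    (F k `*` G k)).
  apply: measurable_fun_pair => //; last exact: measurableX.
    exact: measurable_tnth.
  exact: measurable_behead.
rewrite /cons_measure /pushforward (_ : _ @^-1` _ = F k `*` G k).
  rewrite [ltLHS]product_measure1E //.
  by apply: lte_mul_pinfty => //; rewrite ge0_fin_numE.
have beheadK p : [tuple of behead (tuple_cons p)] = p.2 by apply/val_inj.
have theadK p : thead (tuple_cons p) = p.1 by rewrite /tuple_cons theadE.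
by apply/seteqP; split=> p /=; rewrite beheadK theadK.
Qed.

HB.instance Definition _ := Measure_isSigmaFinite.Build _ _ _ cons_measure
  cons_measure_sigma_finite.

End tuple_lebesgue_step.

Fixpoint tuple_lebesgue (R : realType) (n : nat) :
    {sigma_finite_measure set (n.-tuple R) -> \bar R} :=
  if n is n'.+1 then cons_measure (tuple_lebesgue R n') else \d_[tuple].

Section lebesgue_rV.
Context {R : realType} {n : nat}.

Definition row_of_tuple (t : n.-tuple R) : 'rV[R]_n := \row_j tnth t j.

Lemma measurable_row_of_tuple : measurable_fun [set: n.-tuple R] row_of_tuple.
Proof.
pose box (q : 'rV[rat]_n) (k : nat) : set 'rV[R]_n :=
  [set x | forall j, `|x 0 j - ratr (q 0 j)| < k.+1%:R^-1].
have mbox q k : measurable (row_of_tuple @^-1` box q k).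
  rewrite (_ : _ @^-1` _ = \bigcap_(j in [set: 'I_n])
      [set t | `|tnth t j - ratr (q 0 j)| < k.+1%:R^-1]); last first.
    apply/seteqP; split=> t /=.
      by move=> tq j _; have := tq j; rewrite mxE.
    by move=> tq j; rewrite mxE; exact: tq.
  apply: fin_bigcap_measurable => [|j _]; first exact: finite_finset.
  rewrite (_ : [set _ | _] = (@tnth n R ^~ j) @^-1`
      [set x | `|x - ratr (q 0 j)| < k.+1%:R^-1]) //.
  rewrite -[X in measurable X]setTI; apply: measurable_tnth => //.
  rewrite (_ : [set _ | _] = ball (ratr (q 0 j) : R) k.+1%:R^-1).
    by rewrite ball_itv; exact: measurable_itv.
  by apply/seteqP; split=> x; rewrite /ball/= distrC.
apply: (measurability (@open 'rV[R]_n)) => // _ [U oU <-]; rewrite setTI.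
rewrite (_ : _ @^-1` _ = \bigcup_(p : 'rV[rat]_n * nat)
    (if `[< box p.1 p.2 `<=` U >] then row_of_tuple @^-1` box p.1 p.2
     else set0)).
  apply: countable_bigcupT_measurable => [|[q k]]; first exact: countableP.
  by case: ifP.
apply/seteqP; split=> t /=; last first.
  by case=> -[q k] _ /=; case: ifPn => // /asboolP; apply.
move=> Ut; have /nbhs_ballP[e /= e0 eU] : nbhs (row_of_tuple t) U.
  exact: open_nbhs_nbhs.
have [k ke] : exists k, 2 * k.+1%:R^-1 < e.
  exists (Num.truncn (2 / e)).
  by rewrite ltr_pdivrMr // mulrC -ltr_pdivrMr // truncnS_gt.
have qP j : exists q : rat, `|row_of_tuple t 0 j - ratr q| < k.+1%:R^-1.
  have [|q] := @rat_in_itvoo R (tnth t j - k.+1%:R^-1) (tnth t j + k.+1%:R^-1).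
    by rewrite ltrD2l gtrN // invr_gt0.
  by rewrite in_itv /= => qt; exists q; rewrite mxE distrC ltr_distl.
pose q : 'rV[rat]_n := \row_j xchoose (qP j).
have tq : box q k (row_of_tuple t).
  by move=> j; rewrite [q _ _]mxE; exact: (xchooseP (qP j)).
exists (q, k) => //=; case: ifPn => // /asboolP[] x xq.
apply: eU; split=> // i j; rewrite ord1 /ball /=.
apply: le_lt_trans ke; rewrite mulr_natl mulr2n.
rewrite (le_trans (ler_distD (ratr (q 0 j)) _ _)) // lerD //.
  exact/ltW/tq.
by rewrite distrC; exact/ltW/xq.
Qed.

Definition lebesgue_rV : set 'rV[R]_n -> \bar R :=
  pushforward (tuple_lebesgue R n) row_of_tuple.

Let lebesgue_rV0 : lebesgue_rV set0 = 0%E.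
Proof. by rewrite /lebesgue_rV /pushforward preimage_set0 measure0. Qed.

Let lebesgue_rV_ge0 A : (0 <= lebesgue_rV A)%E.
Proof. by rewrite /lebesgue_rV /pushforward measure_ge0. Qed.

Let lebesgue_rV_sigma_additive : semi_sigma_additive lebesgue_rV.
Proof.
exact: (@measure_semi_sigma_additive _ _ _
  (measure_function_pushforward__canonical__measure_function_Measure
     (tuple_lebesgue R n) measurable_row_of_tuple)).
Qed.

HB.instance Definition _ := isMeasure.Build _ _ _ lebesgue_rV
  lebesgue_rV0 lebesgue_rV_ge0 lebesgue_rV_sigma_additive.

End lebesgue_rV.

Section euclidean.
Context {R : realType}.

(* The library norm on matrices is the maximum of the entries; this is the
   Euclidean norm of row vectors and the Frobenius norm of matrices. *)
Definition enorm (m n : nat) (A : 'M[R]_(m, n)) : R :=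
  Num.sqrt (\sum_i \sum_j A i j ^+ 2).

Context {d : nat}.
Local Notation E := 'rV[R]_d.

Definition eball (r : R) : set E := [set x | enorm x < r].

Definition cross (r : R) : set (E * E) :=
  (eball r `*` setT) `|` (setT `*` eball r).

Definition biball (r s : R) : set (E * E) :=
  (eball r `*` eball s) `|` (eball s `*` eball r).

End euclidean.

Section smoothness.
Context {R : realType}.

Definition C1_on (V : normedModType R) (U : set V) (f : V -> R) : Prop :=
  (forall p, U p -> differentiable f p) /\
  forall v p, U p -> {for p, continuous (fun q => 'D_v f q)}.

Definition C2_on (V : normedModType R) (U : set V) (f : V -> R) : Prop :=
  C1_on U f /\ forall v, C1_on U (fun q => 'D_v f q).

(* C^2 on a compact set: the function is given together with a C^2 extension
   to an open neighbourhood, and the derivatives are those of the extension. *)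
Definition C2_near (V : normedModType R) (K : set V) (f : V -> R) : Prop :=
  exists U : set V, [/\ open U, K `<=` U & C2_on U f].

Context {d : nat}.
Local Notation E := 'rV[R]_d.
Implicit Types (c : E * E -> R) (z : E * E).

Definition grad_x c z : E := \row_i 'D_(delta_mx 0 i, 0) c z.

Definition grad_y c z : E := \row_j 'D_(0, delta_mx 0 j) c z.

Definition hess_xy c z : 'M[R]_d :=
  \matrix_(i, j) 'D_(delta_mx 0 i, 0) (fun z' => 'D_(0, delta_mx 0 j) c z') z.

Definition c_monotone c (S : set (E * E)) : Prop :=
  forall x y x' y', S (x, y) -> S (x', y') ->
    c (x, y) + c (x', y') <= c (x, y') + c (x', y).

Definition C0norm (m n : nat) (T : Type) (f : T -> 'M[R]_(m, n)) (S : set T) :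
    \bar R :=
  ereal_sup [set (enorm (f z))%:E | z in S].

End smoothness.

Section transport.
Context {R : realType} {d : nat}.
Local Notation E := 'rV[R]_d.
Local Open Scope ereal_scope.

Definition Spt (pi : set (E * E) -> \bar R) : set (E * E) :=
  [set z | forall U, open U -> U z -> 0 < pi U].

Definition couplings (mu nu : set E -> \bar R) :
    set {measure set (E * E) -> \bar R} :=
  [set pi | forall A, measurable A ->
    pi (fst @^-1` A) = mu A /\ pi (snd @^-1` A) = nu A].

Definition quad_cost (z : E * E) : \bar R := (enorm (z.1 - z.2) ^+ 2 / 2)%:E.

Definition W2 (mu nu : set E -> \bar R) : \bar R :=
  ereal_inf [set \int[pi]_z quad_cost z | pi in couplings mu nu].

Definition density (r : R) (mu : set E -> \bar R) : \bar R :=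
  mu (eball r) / lebesgue_rV (@eball R d r).

Definition W2_ball (r : R) (mu : set E -> \bar R) : \bar R :=
  W2 (fun A => mu (A `&` eball r))
     (fun A => density r mu * lebesgue_rV (A `&` eball r)).

(* (k - 1)^2 / k, with value +oo at k = 0 (as (0^-1)%E = +oo) and at
   k = +oo (which the formula itself would send to 0). *)
Definition density_defect (k : \bar R) : \bar R :=
  if k is k'%:E then ((k' - 1) ^+ 2)%:E / k'%:E else +oo.

Definition local_energy (r : R) (pi : set (E * E) -> \bar R) : \bar R :=
  (r ^- (d + 2))%:E * \int[pi]_(z in cross r) quad_cost z.

Definition data_defect (r : R) (mu nu : set E -> \bar R) : \bar R :=
  (r ^- (d + 2))%:E * W2_ball r mu + density_defect (density r mu)
  + (r ^- (d + 2))%:E * W2_ball r nu + density_defect (density r nu).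

End transport.

(* Main.v *)
Require Import Defs.
From HB Require Import structures.
From mathcomp Require Import all_boot all_order all_algebra.
From mathcomp Require Import all_classical all_reals all_analysis.
From mathcomp Require Import measurable_realfun ring lra.
Set Implicit Arguments.
Unset Strict Implicit.
Unset Printing Implicit Defensive.
Import Order.TTheory GRing.Theory Num.Theory.
Import numFieldNormedType.Exports.
Local Open Scope classical_set_scope.
Local Open Scope ring_scope.

(** The bound compares an arbitrary point (x, y) of the support with a test
    point (x', y') of the support that is well placed. Two facts drive it.

    First, c-monotonicity is almost ordinary monotonicity. The mixed second
    difference of c over the rectangle with corners (x', y') and (x, y) equals
    (x - x')^T H (y - y') for the matrix H of mixed derivatives at some point of
    the rectangle ([second_difference_MVT]). As H is within e of minus the
    identity, c-monotonicity gives
      (x - x') . (y - y') >= - e |x - x'| |y - y'|     ([c_monotone_frob]).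
    If x' is near x + rho n, where n is the direction of y - x, and y' is near
    x', the left side is about - rho |x - y| + O(rho^2), so that |x - y| is at
    most a multiple of rho ([displacement_le_step]). The error is proportional to
    |y - y'|, which is why no constant depends on Lambda.

    Second, test points exist at every scale rho that is large compared with
    r t^(1/(d+2)), where t is the sum of the energy and of the data defect
    ([test_point]). Transport cost w between mu and a multiple k >= 1/2 of the
    Lebesgue measure can remove at most 2 w / h^2 of the mass of a cube of
    half-side h, by Chebyshev's inequality on displacements larger than h
    ([cube_mass]); hence the cube of half-side 2 h has mu-mass of order h^d at
    least. By Chebyshev's inequality for the energy, not all of this mass can be
    displaced by more than h. Both estimates need w << h^(d+2), which is where
    the exponent 1/(d+2) comes from. The support has full measure because the
    topology has a countable base ([Spt_meets]), so that a set of positive mass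
    contains a point of the support.

    The roles of x and y are exchanged when y, instead of x, lies in the small
    ball. Rectangles must stay inside the region where the Hessian bound holds,
    which requires Lambda to be not much smaller than 5; a test point near a
    point of norm 19/4 r shows that Lambda > 9/2. Letting the scale decrease to
    48 r t^(1/(d+2)) gives the estimate, also when t = 0. *)

(** * Euclidean geometry of row vectors *)

Section frobenius.
Context {R : realType}.

(** On row vectors, the Euclidean inner product; matrices are needed because
    the bilinear form u^T H v is the product of H with the rank one matrix
    [enorm_tens]. *)
Definition frob (m n : nat) (A B : 'M[R]_(m, n)) : R :=
  \sum_i \sum_j A i j * B i j.

Context {m n : nat}.
Implicit Types A B C : 'M[R]_(m, n).

Lemma frobC A B : frob A B = frob B A.
Proof. by apply: eq_bigr => i _; apply: eq_bigr => j _; rewrite mulrC. Qed.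

Lemma frobDl A B C : frob (A + B) C = frob A C + frob B C.
Proof.
rewrite /frob -big_split; apply: eq_bigr => i _ /=.
by rewrite -big_split; apply: eq_bigr => j _ /=; rewrite mxE mulrDl.
Qed.

Lemma frobZl a A B : frob (a *: A) B = a * frob A B.
Proof.
rewrite /frob mulr_sumr; apply: eq_bigr => i _.
by rewrite mulr_sumr; apply: eq_bigr => j _; rewrite mxE mulrA.
Qed.

Lemma frobNl A B : frob (- A) B = - frob A B.
Proof. by rewrite -scaleN1r frobZl mulN1r. Qed.

Lemma frobDr A B C : frob C (A + B) = frob C A + frob C B.
Proof. by rewrite !(frobC C) frobDl. Qed.

Lemma frobZr a A B : frob B (a *: A) = a * frob B A.
Proof. by rewrite !(frobC B) frobZl. Qed.

Lemma frobNr A B : frob A (- B) = - frob A B.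
Proof. by rewrite !(frobC A) frobNl. Qed.

Lemma enorm_ge0 A : 0 <= enorm A.
Proof. exact: sqrtr_ge0. Qed.

Lemma frobAA A : frob A A = enorm A ^+ 2.
Proof.
rewrite /enorm; under [X in Num.sqrt X]eq_bigr do under eq_bigr do rewrite expr2.
rewrite sqr_sqrtr//.
by apply: sumr_ge0 => i _; apply: sumr_ge0 => j _; rewrite -expr2 sqr_ge0.
Qed.

Lemma enormN A : enorm (- A) = enorm A.
Proof.
by congr Num.sqrt; apply: eq_bigr => i _; apply: eq_bigr => j _; rewrite mxE sqrrN.
Qed.

Lemma enormZ a A : enorm (a *: A) = `|a| * enorm A.
Proof.
apply/eqP; rewrite -(@eqrXn2 _ 2)// ?mulr_ge0 ?enorm_ge0//.
by rewrite exprMn -!frobAA frobZl frobZr real_normK ?num_real// expr2 mulrA.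
Qed.

Lemma ler_entry_enorm A i j : `|A i j| <= enorm A.
Proof.
rewrite -sqrtr_sqr ler_wsqrtr// (bigD1 i)//= (bigD1 j)//= -addrA lerDl.
by rewrite addr_ge0// sumr_ge0// => k _; rewrite ?sumr_ge0// => *; rewrite sqr_ge0.
Qed.

Lemma enorm_eq0 A : enorm A = 0 -> A = 0.
Proof.
move=> A0; apply/matrixP => i j; rewrite mxE.
by apply/normr0_eq0/le_anti; rewrite normr_ge0 andbT -A0 ler_entry_enorm.
Qed.

(** Cauchy-Schwarz: expand the square norm of |B| A - |A| B. *)
Lemma le_frob_enorm A B : frob A B <= enorm A * enorm B.
Proof.
have [/enorm_eq0 ->|A0] := eqVneq (enorm A) 0.
  by rewrite -[X in frob X _](scale0r A) frobZl mul0r mulr_ge0 ?enorm_ge0.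
have [/enorm_eq0 ->|B0] := eqVneq (enorm B) 0.
  by rewrite -[X in frob _ X](scale0r B) frobZr mul0r mulr_ge0 ?enorm_ge0.
have AB : 0 < enorm A * enorm B by rewrite mulr_gt0// lt_def enorm_ge0 ?A0 ?B0.
have := sqr_ge0 (enorm (enorm B *: A - enorm A *: B)).
rewrite -frobAA frobDl !frobDr !(frobNl, frobNr) !(frobZl, frobZr) !frobAA (frobC B A).
move: AB; set a := enorm A; set b := enorm B; set c := frob A B => ab H.
have {}H : 0 <= (a * b) * (a * b - c) by lra.
by rewrite pmulr_rge0// subr_ge0 in H.
Qed.

Lemma ler_frob_enorm A B : `|frob A B| <= enorm A * enorm B.
Proof. by rewrite ler_norml lerNl -frobNl -{1}(enormN A) !le_frob_enorm. Qed.

Lemma ler_enormD A B : enorm (A + B) <= enorm A + enorm B.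
Proof.
rewrite -ler_sqr ?nnegrE ?addr_ge0 ?enorm_ge0//.
rewrite -frobAA frobDl !frobDr !frobAA (frobC B A).
by have := le_frob_enorm A B; lra.
Qed.

Lemma ler_enormB A B : enorm (A - B) <= enorm A + enorm B.
Proof. by rewrite -(enormN B) ler_enormD. Qed.

End frobenius.

Section row_vectors.
Context {R : realType} {d : nat}.
Implicit Types u v : 'rV[R]_d.

(** Compares the Euclidean norm with the maximum norm, whose balls are the
    cubes used as test sets; the constant d instead of sqrt d is enough. *)
Lemma enorm_le_coord v a : 0 <= a -> (forall j, `|v 0 j| <= a) ->
  enorm v <= d%:R * a.
Proof.
move=> a0 va; rewrite -ler_sqr ?nnegrE ?mulr_ge0 ?enorm_ge0//.
rewrite -frobAA /frob big_ord1 exprMn; apply: (@le_trans _ _ (d%:R * a ^+ 2)).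
  rewrite -[X in X%:R](card_ord d) mulr_natl -sumr_const ler_sum// => j _.
  by rewrite -expr2 -real_normK ?num_real// ler_sqr ?nnegrE.
by rewrite ler_wpM2r ?sqr_ge0// -natrX ler_nat; case: (d) => // k; rewrite leq_pmulr.
Qed.

Lemma enorm_tens u v : enorm (\matrix_(i, j) (u 0 i * v 0 j)) = enorm u * enorm v.
Proof.
apply/eqP; rewrite -(@eqrXn2 _ 2)// ?mulr_ge0 ?enorm_ge0//.
rewrite exprMn -!frobAA /frob !big_ord1 mulr_suml; apply/eqP/eq_bigr => i _.
rewrite mulr_sumr; apply: eq_bigr => j _; rewrite !mxE; ring.
Qed.

End row_vectors.

(** * Mixed second differences and almost monotonicity *)

Section mixed_differences.
Context {R : realType}.

(** The difference quotients of both sides are the same function. *)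
Lemma is_derive_line (V : normedModType R) (f : V -> R) (a v : V) (t : R) :
  differentiable f (a + t *: v) ->
  is_derive t 1 (fun s => f (a + s *: v)) ('D_v f (a + t *: v)).
Proof.
move=> /diff_derivable => /(_ v) dfa.
have E : (fun h : R => h^-1 *: (((fun s => f (a + s *: v)) \o shift t) (h *: 1) -
    f (a + t *: v))) =
  (fun h : R => h^-1 *: ((f \o shift (a + t *: v)) (h *: v) - f (a + t *: v))).
  apply/funext => h /=; congr (_ *: (f _ - _)).
  by rewrite [_%:A]mulr1 scalerDl addrCA.
by apply: DeriveDef; rewrite /derivable /derive E.
Qed.

(** The mean value theorem is used twice: along v for the increment of f in
    the direction u, then along u for the derivative of f in the direction v. *)
Lemma second_difference_MVT (V : normedModType R) (U : set V) (f : V -> R)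
    (a u v : V) :
  C2_on U f ->
  (forall s t : R, 0 <= s <= 1 -> 0 <= t <= 1 -> U (a + s *: u + t *: v)) ->
  exists s t : R, [/\ 0 <= s <= 1, 0 <= t <= 1 &
    f (a + u + v) + f a - f (a + u) - f (a + v) =
    'D_u (fun q => 'D_v f q) (a + s *: u + t *: v)].
Proof.
move=> [[df _] d2f] aU.
have I0 : 0 <= (0 : R) <= 1 by rewrite lexx ler01.
have I1 : 0 <= (1 : R) <= 1 by rewrite lexx ler01.
have Ua (t : R) : 0 <= t <= 1 -> U (a + t *: v).
  by move=> /(aU _ _ I0); rewrite scale0r addr0.
have Uau (t : R) : 0 <= t <= 1 -> U (a + u + t *: v).
  by move=> /(aU _ _ I1); rewrite scale1r.
pose g t := f (a + u + t *: v) - f (a + t *: v).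
have dg (t : R) : 0 <= t <= 1 ->
    is_derive t 1 g ('D_v f (a + u + t *: v) - 'D_v f (a + t *: v)).
  by move=> t01; apply: is_deriveB; apply: is_derive_line; apply: df; auto.
have [||t /=] := @MVT_segment R g
    (fun t => 'D_v f (a + u + t *: v) - 'D_v f (a + t *: v)) 0 1 ler01.
- by move=> t; rewrite in_itv/= => /andP[? ?]; apply: dg; rewrite !ltW.
- apply: derivable_within_continuous => t; rewrite in_itv/= => t01.
  by have [] := dg _ t01.
rewrite in_itv/= => t01; rewrite subr0 mulr1 => gE.
pose h s := 'D_v f (a + t *: v + s *: u).
have dh (s : R) : 0 <= s <= 1 ->
    is_derive s 1 h ('D_u (fun q => 'D_v f q) (a + t *: v + s *: u)).
  move=> s01; apply: (@is_derive_line _ (fun q => 'D_v f q)).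
  by have [+ _] := d2f v; apply; rewrite addrAC; apply: aU.
have [||s /=] := @MVT_segment R h
    (fun s => 'D_u (fun q => 'D_v f q) (a + t *: v + s *: u)) 0 1 ler01.
- by move=> s; rewrite in_itv/= => /andP[? ?]; apply: dh; rewrite !ltW.
- apply: derivable_within_continuous => s; rewrite in_itv/= => s01.
  by have [] := dh _ s01.
rewrite in_itv/= => s01; rewrite subr0 mulr1 => hE.
exists s, t; split; [exact: s01|exact: t01|].
rewrite [a + s *: u + _]addrAC -hE /h scale1r scale0r addr0 [a + t *: v + u]addrAC.
by rewrite -gE /g !scale1r !scale0r !addr0; ring.
Qed.

Context {d : nat}.
Local Notation E := 'rV[R]_d.

Lemma derive_diff_sum (V : normedModType R) (f : V -> R) (z : V)
    (e : 'I_d -> V) (a : 'I_d -> R) : differentiable f z ->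
  'D_(\sum_i a i *: e i) f z = \sum_i a i * 'D_(e i) f z.
Proof.
move=> df; rewrite deriveE// linear_sum; apply: eq_bigr => i _.
by rewrite linearZ/= deriveE.
Qed.

(** At the points of U, where c is differentiable, directional derivatives are
    linear in the direction; as U is open, the inner derivative may be expanded
    under the outer one. *)
Lemma mixed_derive_hess (U : set (E * E)) (c : E * E -> R) (z : E * E) (u v : E) :
  open U -> C2_on U c -> U z ->
  'D_(u, 0) (fun q => 'D_(0, v) c q) z =
  frob (hess_xy c z) (\matrix_(i, j) (u 0 i * v 0 j)).
Proof.
move=> oU [[dc _] d2c] Uz.
have uE : (u, 0 : E) = \sum_i u 0 i *: (delta_mx 0 i : E, 0 : E).
  apply: injective_projections => /=.
    by rewrite (raddf_sum fst)/= [LHS]row_sum_delta.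
  by rewrite (raddf_sum snd)/= big1// => i _; rewrite scaler0.
have vE : (0 : E, v) = \sum_j v 0 j *: (0 : E, delta_mx 0 j : E).
  apply: injective_projections => /=.
    by rewrite (raddf_sum fst)/= big1// => i _; rewrite scaler0.
  by rewrite (raddf_sum snd)/= [LHS]row_sum_delta.
have -> : 'D_(u, 0) (fun q => 'D_(0, v) c q) z =
    'D_(u, 0) (\sum_j v 0 j *: (fun q => 'D_(0, delta_mx 0 j) c q)) z.
  apply: near_eq_derive; near=> q; rewrite vE fct_sumE derive_diff_sum//.
  by apply: dc; near: q; exact: open_nbhs_nbhs.
rewrite uE derive_diff_sum; last first.
  apply: differentiable_sum => j; apply: differentiableZ.
  by have [+ _] := d2c (0, delta_mx 0 j); apply.
rewrite /frob; apply: eq_bigr => i _.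
rewrite derive_sum; last first.
  move=> j; apply: derivableZ; apply: diff_derivable.
  by have [+ _] := d2c (0, delta_mx 0 j); apply.
rewrite mulr_sumr; apply: eq_bigr => j _.
rewrite deriveZ; last first.
  apply: diff_derivable.
  by have [+ _] := d2c (0, delta_mx 0 j); apply.
by rewrite !mxE /GRing.scale/=; ring.
Unshelve. all: by end_near. Qed.

Lemma frob1_tens (u v : E) : frob 1%:M (\matrix_(i, j) (u 0 i * v 0 j)) = frob u v.
Proof.
rewrite /frob big_ord1; apply: eq_bigr => i _.
rewrite (bigD1 i)//= big1 ?addr0 => [|j ji]; last first.
  by rewrite !mxE eq_sym (negbTE ji) mul0r.
by rewrite !mxE eqxx mul1r.
Qed.

(** The second difference is nonpositive by c-monotonicity, and equal to
    u^T H v = - u . v + u^T (H + 1) v with u = x - x' and v = y - y'. *)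
Lemma c_monotone_frob (K S : set (E * E)) (c : E * E -> R) (e : R) (x y x' y' : E) :
  C2_near K c -> S `<=` K ->
  (forall z, S z -> enorm (hess_xy c z + 1%:M) <= e) ->
  (forall s t : R, 0 <= s <= 1 -> 0 <= t <= 1 ->
    S (x' + s *: (x - x'), y' + t *: (y - y'))) ->
  c (x, y) + c (x', y') <= c (x, y') + c (x', y) ->
  - (e * enorm (x - x') * enorm (y - y')) <= frob (x - x') (y - y').
Proof.
move=> [U [oU KU c2]] SK hS rect mono.
set u := x - x'; set v := y - y'.
have lineE (s t : R) : (x', y') + s *: (u, 0 : E) + t *: (0 : E, v) =
    (x' + s *: u, y' + t *: v).
  by apply: injective_projections; rewrite /= !scaler0 !addr0.
have [|s [t [s01 t01]]] := second_difference_MVT (a := (x', y')) (u := (u, 0))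
    (v := (0, v)) c2.
  by move=> s t s01 t01; rewrite lineE; apply/KU/SK/rect.
have e1 := lineE 1 1; have e2 := lineE 1 0; have e3 := lineE 0 1.
rewrite !scale1r !scale0r ?addr0 in e1 e2 e3.
rewrite e1 e2 e3 lineE !subrKC => cE.
have Sst : S (x' + s *: u, y' + t *: v) by exact: rect.
move: cE; rewrite (mixed_derive_hess _ _ oU)//; last exact/KU/SK.
set H := hess_xy c _; set T := \matrix_(i, j) _ => cE.
have : frob H T <= 0 by rewrite -cE; lra.
have HT : `|frob (H + 1%:M) T| <= e * enorm u * enorm v.
  apply: le_trans (ler_frob_enorm _ _) _; rewrite enorm_tens -mulrA.
  by rewrite ler_wpM2r ?mulr_ge0 ?enorm_ge0//; exact: hS.
move: HT; rewrite -(frob1_tens u v) -/T ler_norml frobDl => /andP[+ _].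
lra.
Qed.

End mixed_differences.

(** * Borel structure of the product and the support of a measure *)

Section borel_product.
Context {R : realType} {d : nat}.
Local Notation E := 'rV[R]_d.

Lemma ball_rVP (x y : E) (e : R) : 0 < e ->
  ball x e y <-> (forall j, `|x 0 j - y 0 j| < e).
Proof.
move=> e0; split=> [[_ xy] j|xy]; first exact: xy.
by split=> // i j; rewrite ord1; exact: xy.
Qed.

Lemma measurable_open_rV (U : set E) : open U -> measurable U.
Proof. exact: sub_gen_smallest. Qed.

Lemma measurable_ball_rV (x : E) (e : R) : measurable (ball x e).
Proof. apply: measurable_open_rV; exact: ball_open. Qed.

(** A countable base of the topology of the product, made of measurable
    rectangles. *)
Definition rat_box (q : 'rV[rat]_d * 'rV[rat]_d * nat) : set (E * E) :=
  ball (map_mx ratr q.1.1 : E) q.2.+1%:R^-1 `*`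
  ball (map_mx ratr q.1.2 : E) q.2.+1%:R^-1.

Lemma measurable_rat_box q : measurable (rat_box q).
Proof. by apply: measurableX; exact: measurable_ball_rV. Qed.

Lemma rat_row_dense (x : E) (e : R) : 0 < e ->
  exists q : 'rV[rat]_d, ball (map_mx ratr q : E) e x.
Proof.
move=> e0.
have qP j : exists q : rat, `|ratr q - x 0 j| < e.
  have [|q] := @rat_in_itvoo R (x 0 j - e) (x 0 j + e); first by lra.
  by rewrite in_itv /= => qx; exists q; rewrite ltr_distl.
exists (\row_j xchoose (qP j)); apply/ball_rVP => // j; rewrite !mxE.
exact: (xchooseP (qP j)).
Qed.

Lemma rat_box_basis (U : set (E * E)) z : open U -> U z ->
  exists2 q, rat_box q z & rat_box q `<=` U.
Proof.
move=> oU Uz; have /nbhs_ballP[e /= e0 eU] : nbhs z U by exact: open_nbhs_nbhs.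
have [k ke] : exists k, 2 * k.+1%:R^-1 < e.
  exists (Num.truncn (2 / e)).
  by rewrite ltr_pdivrMr // mulrC -ltr_pdivrMr // truncnS_gt.
have k0 : 0 < k.+1%:R^-1 :> R by rewrite invr_gt0.
have [q1 zq1] := rat_row_dense z.1 k0.
have [q2 zq2] := rat_row_dense z.2 k0.
exists (q1, q2, k) => // y [/= yq1 yq2]; apply: eU.
by split; apply: (le_ball (ltW ke)); rewrite mulr_natl mulr2n;
  apply: ball_triangle; [apply/ball_sym; eassumption|eassumption|
    apply/ball_sym; eassumption|eassumption].
Qed.

(** The sigma-algebra of the product is generated by rectangles; it contains the
    open sets because they are countable unions of rational boxes. *)
Lemma measurable_open_prod (U : set (E * E)) : open U -> measurable U.
Proof.
move=> oU; rewrite (_ : U = \bigcup_q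
    (if `[< rat_box q `<=` U >] then rat_box q else set0)).
  apply: countable_bigcupT_measurable => [|q]; first exact: countableP.
  by case: ifP => // _; exact: measurable_rat_box.
apply/seteqP; split=> z; last by case=> q _; case: ifPn => // /asboolP; apply.
move=> /(rat_box_basis oU)[q zq qU]; exists q => //.
by case: ifPn => // /asboolP[].
Qed.

(** The complement of the support is the union of the countably many null
    rational boxes, hence is null. *)
Lemma Spt_meets (pi : {measure set (E * E) -> \bar R}) (A : set (E * E)) :
  measurable A -> (0 < pi A)%E -> (Spt pi `&` A) !=set0.
Proof.
move=> mA pA; apply/set0P/eqP => SA.
pose F (n : nat) : set (E * E) := match unpickle n with
  | Some q => if pi (rat_box q) == 0%E then rat_box q else set0
  | None => set0 end.
have Fnull : pi.-negligible (\bigcup_n F n).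
  apply: negligible_bigcup => n; rewrite /F.
  case: unpickle => [q|]; last exact: negligible_set0.
  case: ifPn => [/eqP q0|_]; last exact: negligible_set0.
  by exists (rat_box q); split => //; exact: measurable_rat_box.
suff AF : A `<=` \bigcup_n F n.
  have /negligibleP A0 : pi.-negligible A by exact: negligibleS Fnull.
  by rewrite A0 ?ltxx in pA.
move=> z Az.
have /existsNP[U] : ~ Spt pi z by move=> Sz; rewrite -[False]/(set0 z) -SA.
move=> /not_implyP[oU /not_implyP[Uz /negP]]; rewrite -leNgt => U0.
have [q zq qU] := rat_box_basis oU Uz.
exists (pickle q) => //; rewrite /F pickleK.
rewrite (_ : (pi _ == 0)%E)//; apply/eqP/le_anti; rewrite measure_ge0 andbT.
apply: le_trans U0; apply: le_measure => //; rewrite inE.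
  exact: measurable_rat_box.
exact: measurable_open_prod.
Qed.

End borel_product.

(** * Volume of cubes *)

Section cube_volume.
Context {R : realType}.

Let tuple_cube n (a : 'I_n -> R) (h : R) : set (n.-tuple R) :=
  [set t | forall j, `|a j - tnth t j| < h].

Let mball (x h : R) : measurable (ball x h).
Proof. by rewrite ball_itv; exact: measurable_itv. Qed.

Let measurable_tuple_cube n (a : 'I_n -> R) (h : R) : measurable (tuple_cube a h).
Proof.
rewrite (_ : tuple_cube a h = \bigcap_(j in [set: 'I_n])
    [set t | `|a j - tnth t j| < h]); last first.
  by apply/seteqP; split=> t /= H j; [move=> _|]; exact: H.
apply: fin_bigcap_measurable => [|j _]; first exact: finite_finset.
rewrite -[X in measurable X]setTI.
rewrite [X in _ `&` X](_ : _ = (@tnth n R ^~ j) @^-1` ball (a j) h)//.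
by apply: measurable_tnth => //; exact: mball.
Qed.

Let tuple_lebesgue_cube n (a : 'I_n -> R) (h : R) : 0 < h ->
  tuple_lebesgue R n (tuple_cube a h) = ((2 * h) ^+ n)%:E.
Proof.
move=> h0; elim: n a => [|n IH] a /=.
  by rewrite diracE expr0 mem_set// => -[].
rewrite /cons_measure /pushforward.
rewrite (_ : _ @^-1` _ = ball (a ord0) h `*` tuple_cube (a \o lift ord0) h).
  rewrite product_measure1E; [|exact: mball|exact: measurable_tuple_cube].
  transitivity ((h *+ 2)%:E * ((2 * h) ^+ n)%:E)%E.
    by congr (_ * _)%E; [exact: (lebesgue_measure_ball _ (ltW h0))|exact: IH].
  by rewrite -EFinM exprS mulr_natl.
apply/seteqP; split=> -[x t] /=.
  move=> H; split=> [|j /=].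
    exact: (H ord0).
  by have := H (lift ord0 j); rewrite tnthS.
move=> [xa ta] j; case: (unliftP ord0 j) => [k|] ->; rewrite ?tnthS.
  exact: ta.
exact: xa.
Qed.

(** The balls of the topology are those of the maximum norm, that is, cubes. *)
Lemma lebesgue_rV_ball d (p : 'rV[R]_d) (h : R) : 0 < h ->
  lebesgue_rV (ball p h) = ((2 * h) ^+ d)%:E.
Proof.
move=> h0; rewrite -(tuple_lebesgue_cube (p 0) h0) /lebesgue_rV /pushforward.
congr (tuple_lebesgue R d _); apply/seteqP; split=> t /=.
  by move=> /ball_rVP => /(_ h0) H j; have := H j; rewrite mxE.
by move=> H; apply/ball_rVP => // j; rewrite mxE.
Qed.

End cube_volume.

(** * Measurability of the cost and Chebyshev's inequality *)

Section measurability_rV.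
Context {R : realType} {d : nat}.
Local Notation E := 'rV[R]_d.

Lemma measurable_coord_rV (j : 'I_d) :
  measurable_fun [set: E] (fun x : E => x 0 j).
Proof.
apply: (measurability _ (RGenOpens.measurableE R)) => _ [_ [a [b ->] <-]].
rewrite setTI; apply: measurable_open_rV.
apply: open_comp; last exact: interval_open.
by move=> x _; exact: coord_continuous.
Qed.

Lemma enorm_rV (x : E) : enorm x = Num.sqrt (\sum_j x 0 j ^+ 2).
Proof. by rewrite /enorm big_ord1. Qed.

Lemma measurable_eball (r : R) : measurable (@eball R d r).
Proof.
rewrite -[X in measurable X]setTI.
have : measurable_fun [set: E] (fun x : E => enorm x).
  under eq_fun do rewrite enorm_rV.
  apply: measurableT_comp; last first.
    apply: measurable_sum => j; apply: measurable_funX.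
    exact: measurable_coord_rV.
  by apply: continuous_measurable_fun; exact: sqrt_continuous.
move=> /(_ measurableT _ (measurable_itv `]-oo, r[)).
by rewrite set_itvE.
Qed.

Lemma measurable_cross (r : R) : measurable (@cross R d r).
Proof. by apply: measurableU; apply: measurableX => //; exact: measurable_eball. Qed.

Lemma measurable_quad_cost : measurable_fun [set: E * E] (@quad_cost R d).
Proof.
apply/measurable_EFinP; apply: measurable_funM => //.
rewrite (_ : (fun z => _) = fun z : E * E => \sum_j (z.1 0 j - z.2 0 j) ^+ 2).
  apply: measurable_sum => j; apply: measurable_funX; apply: measurable_funB.
    exact: (measurableT_comp (measurable_coord_rV j) measurable_fst).
  exact: (measurableT_comp (measurable_coord_rV j) measurable_snd).
apply/funext => z; rewrite -frobAA /frob big_ord1; apply: eq_bigr => j _.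
by rewrite !mxE expr2.
Qed.

Lemma quad_cost_ge0 (z : E * E) : (0 <= quad_cost z)%E.
Proof. by rewrite lee_fin divr_ge0// sqr_ge0. Qed.

Lemma measurable_quad_ge (h : R) :
  measurable [set z : E * E | (h%:E <= quad_cost z)%E].
Proof.
by rewrite -[X in measurable X]setTI; apply: emeasurable_fun_c_infty => //;
  exact: measurable_quad_cost.
Qed.

End measurability_rV.

Section chebyshev.
Context {dp : measure_display} {T : measurableType dp} {R : realType}.

Lemma chebyshev_integral (m : {measure set T -> \bar R}) (D B : set T)
    (f : T -> \bar R) (a : R) : 0 <= a ->
  measurable D -> measurable B -> B `<=` D -> measurable_fun D f ->
  (forall x, D x -> (0 <= f x)%E) -> (forall x, B x -> (a%:E <= f x)%E) ->
  (a%:E * m B <= \int[m]_(x in D) f x)%E.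
Proof.
move=> a0 mD mB BD mf f0 fa.
apply: (@le_trans _ _ (\int[m]_(x in B) f x)%E); last exact: ge0_subset_integral.
rewrite -(integral_cst m mB a%:E); apply: ge0_le_integral => //.
  exact: measurable_funS mf.
Qed.

End chebyshev.

(** * Existence of test points *)

Section test_points.
Context {R : realType} {d : nat}.
Local Notation E := 'rV[R]_d.

Lemma ball_sub_quad (p : E) (h : R) (z : E * E) : 0 < h ->
  ball p h z.2 -> ball p (2 * h) z.1 \/ ((h ^+ 2 / 2)%:E <= quad_cost z)%E.
Proof.
move=> h0 /ball_rVP => /(_ h0) pz2.
have [hz|zh] := leP h (enorm (z.1 - z.2)); [right|left].
  by rewrite lee_fin ler_pM2r ?invr_gt0// ler_sqr// nnegrE ?enorm_ge0// ltW.
apply/ball_rVP => [|j]; first by rewrite mulr_gt0.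
have := ler_entry_enorm (z.1 - z.2) 0 j; rewrite !mxE => zj.
have := ler_distD (z.2 0 j) (p 0 j) (z.1 0 j).
by have := pz2 j; rewrite (distrC (z.2 0 j)); lra.
Qed.

(** Take a nearly optimal coupling of m and k times the Lebesgue measure. The
    mass (2 h)^d k that it sends to the cube of half-side h starts from the cube
    of half-side 2 h, except for the part that travels at least h, whose mass is
    at most w / (h^2 / 2). *)
Lemma cube_mass (m : {measure set E -> \bar R}) (r k w h : R) (p : E) :
  0 < h -> density r m = k%:E -> 2^-1 <= k -> (W2_ball r m < w%:E)%E ->
  ball p h `<=` eball r ->
  (((2 * h) ^+ d / 2 - 2 * w / h ^+ 2)%:E <= m (ball p (2 * h)))%E.
Proof.
move=> h0 mk k2 W pr.
have [_ [q qc <-] qw] := ereal_inf_lt W.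
have [q1 _] := qc _ (measurable_ball_rV p (2 * h)).
have [_ q2] := qc _ (measurable_ball_rV p h).
move: q2; rewrite mk (setIidl pr) lebesgue_rV_ball// -EFinM => q2.
have mf1 : measurable (fst @^-1` (ball p (2 * h)) : set (E * E)).
  by rewrite -[X in measurable X]setTI; apply: measurable_fst => //;
    exact: measurable_ball_rV.
have mf2 : measurable (snd @^-1` (ball p h) : set (E * E)).
  by rewrite -[X in measurable X]setTI; apply: measurable_snd => //;
    exact: measurable_ball_rV.
set B := [set z : E * E | ((h ^+ 2 / 2)%:E <= quad_cost z)%E].
have mB : measurable B by exact: measurable_quad_ge.
have h2 : 0 < h ^+ 2 / 2 by rewrite divr_gt0// exprn_gt0.
have qB : (q B <= (2 * w / h ^+ 2)%:E)%E.
  rewrite (_ : 2 * w / h ^+ 2 = (h ^+ 2 / 2)^-1 * w); last first.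
    by rewrite invf_div; ring.
  rewrite EFinM lee_pdivlMl//; apply: le_trans (ltW qw).
  apply: chebyshev_integral => //; first exact: ltW.
    exact: measurable_quad_cost.
  by move=> z _; exact: quad_cost_ge0.
have : (((2 * h) ^+ d * k)%:E <= q (fst @^-1` ball p (2 * h)) + q B)%E.
  rewrite mulrC -q2; apply: le_trans (measureU2 _ mf1 mB).
  apply: le_measure; rewrite ?inE//; first exact: measurableU.
  by move=> z /(ball_sub_quad h0)[]; [left|right].
rewrite q1 => H.
have mI : (m (ball p (2 * h) `&` eball r) <= m (ball p (2 * h)))%E.
  apply: le_measure; rewrite ?inE; last exact: subIsetl.
    by apply: measurableI; [exact: measurable_ball_rV|exact: measurable_eball].
  exact: measurable_ball_rV.
rewrite EFinB leeBlDr//; apply: le_trans (leeD mI qB).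
apply: le_trans H; rewrite lee_fin ler_wpM2l// exprn_ge0// mulr_ge0//; exact: ltW.
Qed.

(** Here f is the first or the second projection and m the corresponding
    marginal. The value w = h^(d+2) / 8 is such that [cube_mass] leaves mass
    h^d / 4 at least, and displacing this mass by h would cost
    (h^2 / 2) (h^d / 4) = w, more than the energy. *)
Lemma test_point (pi : {measure set (E * E) -> \bar R}) (f : E * E -> E)
    (m : {measure set E -> \bar R}) (r k h : R) (p : E) :
  measurable_fun [set: E * E] f ->
  (forall A, measurable A -> pi (f @^-1` A) = m A) ->
  f @^-1` eball r `<=` cross r ->
  0 < h -> density r m = k%:E -> 2^-1 <= k ->
  (W2_ball r m < (h ^+ (d + 2) / 8)%:E)%E ->
  (\int[pi]_(z in cross r) quad_cost z < (h ^+ (d + 2) / 8)%:E)%E ->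
  ball p (2 * h) `<=` eball r ->
  exists z, [/\ Spt pi z, ball p (2 * h) (f z) & enorm (z.1 - z.2) < h].
Proof.
move=> mf fm fr h0 mk k2 W I pr.
have hd : 0 < h ^+ d by rewrite exprn_gt0.
have mass : ((h ^+ d / 4)%:E <= m (ball p (2 * h)))%E.
  have pr' : ball p h `<=` eball r.
    by apply: subset_trans pr; apply: le_ball; rewrite ler_peMl ?ltW// ltr1n.
  apply: le_trans (cube_mass h0 mk k2 W pr'); rewrite lee_fin.
  have -> : 2 * (h ^+ (d + 2) / 8) / h ^+ 2 = h ^+ d / 4.
    by rewrite exprD; field; rewrite gt_eqF.
  have : h ^+ d <= (2 * h) ^+ d by rewrite lerXn2r ?nnegrE//; lra.
  by lra.
(* B is the set of points displaced by h at least. *)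
pose B := [set z : E * E | ((h ^+ 2 / 2)%:E <= quad_cost z)%E].
have mB : measurable B by exact: measurable_quad_ge.
have mF : measurable (f @^-1` ball p (2 * h)).
  by rewrite -[X in measurable X]setTI; apply: mf => //; exact: measurable_ball_rV.
set F := f @^-1` _ in mF.
have [A0|A0] := eqVneq (pi (F `&` ~` B)) 0%E; last first.
  have [||z [Sz [Fz Bz]]] := @Spt_meets _ _ pi (F `&` ~` B).
  - by apply: measurableI => //; exact: measurableC.
  - by rewrite lt_neqAle eq_sym A0 measure_ge0.
  exists z; split => //; rewrite ltNge; apply/negP => hz; apply: Bz.
  rewrite /B/= lee_fin ler_pM2r ?invr_gt0// ler_sqr// nnegrE ?enorm_ge0//.
  exact: ltW.
have piB : ((h ^+ d / 4)%:E <= pi (F `&` B))%E.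
  apply: (le_trans mass); rewrite -fm; last exact: measurable_ball_rV.
  rewrite -/F -[X in (pi X <= _)%E](setIT F) -(setUv B) setIUr.
  apply: (@le_trans _ _ (pi (F `&` B) + pi (F `&` ~` B))%E).
    by apply: measureU2; apply: measurableI => //; exact: measurableC.
  by rewrite A0 adde0.
have : ((h ^+ 2 / 2)%:E * pi (F `&` B) <= \int[pi]_(z in cross r) quad_cost z)%E.
  apply: chebyshev_integral.
  - by rewrite divr_ge0// exprn_ge0// ltW.
  - exact: measurable_cross.
  - exact: measurableI.
  - by move=> z [Fz _]; apply/fr/pr.
  - exact: measurable_funTS measurable_quad_cost.
  - by move=> z _; exact: quad_cost_ge0.
  - by move=> z [].
move=> /le_lt_trans /(_ I); rewrite ltNge => /negP; case.
apply: (@le_trans _ _ ((h ^+ 2 / 2)%:E * (h ^+ d / 4)%:E)%E).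
  rewrite -EFinM lee_fin exprD; lra.
by rewrite lee_pmul2l// lte_fin divr_gt0// exprn_gt0.
Qed.

End test_points.

(** * Displacement bound from a test point *)

Section displacement.
Context {R : realType} {d : nat}.
Local Notation E := 'rV[R]_d.

Lemma eball_segment (r s : R) (x y : E) : 0 <= s <= 1 ->
  eball r x -> eball r y -> eball r (x + s *: (y - x)).
Proof.
rewrite /eball/= => /andP[s0 s1] xr yr.
have -> : x + s *: (y - x) = (1 - s) *: x + s *: y.
  by rewrite scalerBr scalerBl scale1r addrA addrAC.
apply: le_lt_trans (ler_enormD _ _) _; rewrite !enormZ !ger0_norm ?subr_ge0//.
have [s2|s2] := leP s (1 / 2).
  have : (1 - s) * enorm x < (1 - s) * r by rewrite ltr_pM2l//; lra.
  have : s * enorm y <= s * r by rewrite ler_wpM2l// ltW.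
  by lra.
have : s * enorm y < s * r by rewrite ltr_pM2l//; lra.
have : (1 - s) * enorm x <= (1 - s) * r by rewrite ler_wpM2l ?subr_ge0// ltW.
by lra.
Qed.

Lemma ball_sub_enorm (p x : E) (h : R) : 0 < h -> ball p (2 * h) x ->
  enorm (x - p) <= 2 * (d.+1)%:R * h.
Proof.
move=> h0 /ball_rVP => /(_ ltac:(by rewrite mulr_gt0)) px.
apply: (@le_trans _ _ (d%:R * (2 * h))).
  apply: enorm_le_coord => [|j]; first by rewrite mulr_ge0// ltW.
  by rewrite !mxE distrC ltW.
by rewrite -natr1; nra.
Qed.

(** Let n be the unit vector along y - x, L = |y - x|, u = x - x', v = y - y'.
    Up to the errors allowed for x' and y', u is - rho n and v is L n + u, so
    that u . v is at most - (3/4) rho L + O(rho^2), while almost monotonicity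
    bounds it from below by - e |u| |v| >= - (1/8) rho L - O(rho^2). *)
Lemma displacement_le_step (x y x' y' : E) (rho e : R) :
  0 < rho -> e <= 1 / 10 -> x != y ->
  enorm (x' - (x + (rho / enorm (y - x)) *: (y - x))) <= rho / 4 ->
  enorm (x' - y') <= rho / 8 ->
  - (e * enorm (x - x') * enorm (y - y')) <= frob (x - x') (y - y') ->
  enorm (x - y) <= 4 * rho.
Proof.
move=> rho0 e10 xy.
rewrite -[enorm (x - y)]enormN opprB.
set L := enorm (y - x).
have L0 : 0 < L.
  rewrite lt_def enorm_ge0 andbT; apply: contra xy => /eqP/enorm_eq0/eqP.
  by rewrite subr_eq0 eq_sym.
pose n := L^-1 *: (y - x).
have n1 : enorm n = 1.
  by rewrite enormZ ger0_norm ?invr_ge0 ?enorm_ge0// mulVf// gt_eqF.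
have nE : y - x = L *: n by rewrite scalerA mulfV ?gt_eqF// scale1r.
have -> : (rho / L) *: (y - x) = rho *: n by rewrite scalerA.
set a := x' - _ => ha; rewrite -[enorm (x' - y')]enormN opprB.
set b := y' - x' => hb.
have uE : x - x' = - (rho *: n + a).
  by apply/rowP => j; rewrite /a !mxE; ring.
have vE : y - y' = L *: n + (x - x') - b.
  by rewrite -nE; apply/rowP => j; rewrite /b !mxE; ring.
set u := x - x' in uE vE *; set v := y - y' in vE *.
clearbody u v a b n L.
have un : frob u n <= - (3 / 4) * rho.
  have := ler_frob_enorm a n; rewrite n1 mulr1 ler_norml => /andP[H _].
  by rewrite uE frobNl frobDl frobZl frobAA n1; lra.
have ule : enorm u <= 5 / 4 * rho.
  rewrite uE enormN; apply: le_trans (ler_enormD _ _) _.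
  by rewrite enormZ n1 gtr0_norm//; lra.
have vle : enorm v <= L + 11 / 8 * rho.
  rewrite vE; apply: le_trans (ler_enormB _ _) _.
  have := ler_enormD (L *: n) u; rewrite enormZ n1 gtr0_norm//; lra.
have ub : - frob u b <= enorm u * enorm b.
  by have := ler_frob_enorm u b; rewrite ler_norml => /andP[+ _]; lra.
have -> : frob u v = L * frob u n + enorm u ^+ 2 - frob u b.
  by rewrite vE !frobDr frobNr frobZr frobAA.
have u0 := enorm_ge0 u; have v0 := enorm_ge0 v; have b0 := enorm_ge0 b.
have H1 : L * frob u n <= L * (- (3 / 4) * rho) by rewrite ler_pM2l.
have H2 : enorm u ^+ 2 <= (5 / 4 * rho) ^+ 2 by rewrite lerXn2r ?nnegrE//; lra.
have H3 : enorm u * enorm b <= (5 / 4 * rho) * (rho / 8) by exact: ler_pM.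
have H4 : e * enorm u * enorm v <= 1 / 10 * ((5 / 4 * rho) * (L + 11 / 8 * rho)).
  rewrite -mulrA; apply: (@le_trans _ _ (1 / 10 * (enorm u * enorm v))).
    by rewrite ler_wpM2r// mulr_ge0.
  by rewrite ler_pM2l ?divr_gt0//; exact: ler_pM.
move=> H.
have : 0 <= rho * (121 / 64 * rho - 5 / 8 * L) by lra.
by rewrite pmulr_rge0//; lra.
Qed.

(** The step length is rho = 8 (d + 1) h: a point of the cube of half-side 2 h
    is within 2 (d + 1) h = rho / 4 of its centre, and y' is within h <= rho / 8
    of x'. Since rho <= r / 10, starting from |x| < 4 r all test points have norm
    less than 9/2 r. *)
Lemma displacement_bound (S : set (E * E)) (r h e : R) :
  0 < h -> (d.+1)%:R * h <= r / 80 -> e <= 1 / 10 ->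
  (forall p, enorm p <= 5 * r ->
    exists z, [/\ S z, ball p (2 * h) z.1 & enorm (z.1 - z.2) < h]) ->
  (forall x y x' y', S (x, y) -> S (x', y') ->
    enorm x < 4 * r -> enorm x' < 9 / 2 * r -> enorm y' < 9 / 2 * r ->
    - (e * enorm (x - x') * enorm (y - y')) <= frob (x - x') (y - y')) ->
  forall x y, S (x, y) -> enorm x < 4 * r ->
    enorm (x - y) <= 32 * (d.+1)%:R * h.
Proof.
move=> h0 hr e10 test mono x y Sxy xr.
have h1 : h <= (d.+1)%:R * h by rewrite ler_peMl ?ler1n// ltW.
set D := (d.+1)%:R * h in hr h1.
have [->|xy] := eqVneq x y.
  by rewrite subrr -[X in enorm X](scale0r x) enormZ normr0 mul0r !mulr_ge0// ltW.
set L := enorm (y - x).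
have L0 : L != 0.
  by apply: contra xy => /eqP/enorm_eq0/eqP; rewrite subr_eq0 eq_sym.
set rho := 8 * D.
pose p := x + (rho / L) *: (y - x).
have rho0 : 0 < rho by rewrite /rho; lra.
have px : enorm (p - x) = rho.
  rewrite /p addrAC subrr add0r enormZ -/L ger0_norm.
    by rewrite mulfVK.
  by rewrite divr_ge0 ?enorm_ge0// ltW.
have tri (a b : E) : enorm a <= enorm b + enorm (a - b).
  by rewrite -{1}(subrKC b a) ler_enormD.
have pr : enorm p <= 5 * r by have := tri p x; rewrite px /rho; lra.
have [[x' y'] [/= Sz /(ball_sub_enorm h0) x'p xy']] := test p pr.
rewrite -mulrA -/D in x'p.
have x'r : enorm x' < 9 / 2 * r.
  by have := tri x' p; have := tri p x; rewrite px /rho; lra.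
have y'r : enorm y' < 9 / 2 * r.
  have := tri y' x'; rewrite -[enorm (y' - x')]enormN opprB.
  by have := tri x' p; have := tri p x; rewrite px /rho; lra.
rewrite (_ : 32 * _ * h = 4 * rho); last by rewrite /rho /D; ring.
apply: (displacement_le_step rho0 e10 xy (x' := x') (y' := y')).
- by rewrite -/L -/p /rho; lra.
- by rewrite /rho; lra.
- exact: mono.
Qed.

End displacement.

(** * Reading the smallness assumption *)

Section smallness.
Context {R : realType} {d : nat}.
Local Notation E := 'rV[R]_d.

Lemma W2_ge0 (m m' : set E -> \bar R) : (0 <= W2 m m')%E.
Proof.
apply: le_ereal_inf_tmp => _ [q _ <-]; apply: integral_ge0 => z _.
exact: quad_cost_ge0.
Qed.

Lemma density_ge0 (m : {measure set E -> \bar R}) (r : R) : (0 <= density r m)%E.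
Proof. by apply: mule_ge0; rewrite ?inve_ge0 measure_ge0. Qed.

Lemma density_defect_ge0 (k : \bar R) : (0 <= k)%E -> (0 <= density_defect k)%E.
Proof.
case: k => [k| |]//= k0; apply: mule_ge0; first by rewrite lee_fin sqr_ge0.
by rewrite inve_ge0.
Qed.

(** If k < 1/2, then (k - 1)^2 / k > 1/2. *)
Lemma density_defect_half (k : \bar R) (e : R) : (0 <= k)%E -> e <= 1 / 10 ->
  (density_defect k <= e%:E)%E -> exists2 k', k = k'%:E & 2^-1 <= k'.
Proof.
case: k => [k| |]//=; rewrite lee_fin => k0 e10 H; exists k => //.
have [k00|kn0] := eqVneq k 0.
  by move: H; rewrite k00 inve0 gt0_muley// lte_fin; lra.
move: H; rewrite inver (negbTE kn0) -EFinM lee_fin ler_pdivrMr; last first.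
  by rewrite lt_def kn0.
nra.
Qed.

(** All the terms are nonnegative, so each of them is at most the sum. *)
Lemma smallness_bounds (pi : {measure set (E * E) -> \bar R})
    (mu nu : {measure set E -> \bar R}) (r e : R) : 0 < r ->
  (local_energy r pi + data_defect r mu nu <= e%:E)%E ->
  exists t, [/\ (local_energy r pi + data_defect r mu nu)%E = t%:E,
    0 <= t <= e,
    (\int[pi]_(z in cross r) quad_cost z <= (t * r ^+ (d + 2))%:E)%E,
    (W2_ball r mu <= (t * r ^+ (d + 2))%:E)%E /\
    (W2_ball r nu <= (t * r ^+ (d + 2))%:E)%E &
    (density_defect (density r mu) <= e%:E)%E /\
    (density_defect (density r nu) <= e%:E)%E].
Proof.
move=> r0; set T := (_ + _)%E => Te.
have rd : 0 < r ^+ (d + 2) by rewrite exprn_gt0.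
have ri : (0 <= (r ^- (d + 2))%:E)%E by rewrite lee_fin invr_ge0 ltW.
have I0 : (0 <= local_energy r pi)%E.
  by apply: mule_ge0 => //; apply: integral_ge0 => z _; exact: quad_cost_ge0.
have M0 : (0 <= (r ^- (d + 2))%:E * W2_ball r mu)%E by rewrite mule_ge0// W2_ge0.
have N0 : (0 <= (r ^- (d + 2))%:E * W2_ball r nu)%E by rewrite mule_ge0// W2_ge0.
have Dm0 := density_defect_ge0 (density_ge0 mu r).
have Dn0 := density_defect_ge0 (density_ge0 nu r).
have T0 : (0 <= T)%E by rewrite /T /data_defect !adde_ge0.
have IT : (local_energy r pi <= T)%E by rewrite /T /data_defect leeDl// !adde_ge0.
have DT : (data_defect r mu nu <= T)%E by rewrite /T leeDr.
have MT : ((r ^- (d + 2))%:E * W2_ball r mu <= T)%E.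
  by apply: le_trans DT; rewrite /data_defect -!addeA leeDl// !adde_ge0.
have NT : ((r ^- (d + 2))%:E * W2_ball r nu <= T)%E.
  apply: le_trans DT; apply: le_trans (leeDl _ Dn0).
  exact: leeDr (adde_ge0 M0 Dm0).
have MDT : (density_defect (density r mu) <= T)%E.
  apply: le_trans DT; rewrite /data_defect -addeA.
  by apply: le_trans (leeDl _ (adde_ge0 N0 Dn0)); exact: leeDr.
have NDT : (density_defect (density r nu) <= T)%E.
  by apply: le_trans DT; apply: leeDr; rewrite !adde_ge0.
clearbody T; case: T T0 Te IT MT NT MDT NDT {DT} => [t| |]//.
rewrite !lee_fin => t0 te; rewrite /local_energy !lee_pdivrMl// -!EFinM.
rewrite !(mulrC _ t) => IT MT NT MDT NDT.
exists t; split => //; first by rewrite t0.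
by split; [apply: (le_trans MDT)|apply: (le_trans NDT)]; rewrite lee_fin.
Qed.

End smallness.

(** * The estimate at a fixed scale, and its limit *)

Section displacement_at_scale.
Context {R : realType} {d : nat}.
Local Notation E := 'rV[R]_d.

Lemma enorm_delta (j : 'I_d) : enorm (delta_mx 0 j : E) = 1.
Proof.
rewrite enorm_rV (bigD1 j)//= big1 => [|i ij];
  rewrite !mxE !eqxx ?expr1n ?addr0 ?sqrtr1//.
by rewrite (negbTE ij) expr0n.
Qed.

(** The scale h must satisfy h^(d+2) / 8 > t (6 r)^(d+2), so that both the cost
    and the energy on the ball of radius 6 r are below the threshold of
    [test_point]. *)
Lemma displacement_at_scale (K : set (E * E)) (c : E * E -> R)
    (mu nu : {measure set E -> \bar R}) (pi : {measure set (E * E) -> \bar R})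
    (L r h e : R) (j : 'I_d) :
  C2_near K c -> couplings mu nu pi -> c_monotone c (Spt pi) ->
  0 < r -> biball (5 * r) (L * r) `<=` K ->
  cross (5 * r) `&` Spt pi `<=` biball (5 * r) (L * r) ->
  e <= 1 / 10 ->
  (local_energy (6 * r) pi + data_defect (6 * r) mu nu <= e%:E)%E ->
  (C0norm (fun z => hess_xy c z + 1%:M)%R (biball (5 * r) (L * r)) <= e%:E)%E ->
  0 < h -> (d.+1)%:R * h <= r / 80 ->
  (local_energy (6 * r) pi + data_defect (6 * r) mu nu <
    (h ^+ (d + 2) / (8 * (6 * r) ^+ (d + 2)))%:E)%E ->
  forall x y, (cross (4 * r) `&` Spt pi) (x, y) ->
  enorm (x - y) <= 32 * (d.+1)%:R * h.
Proof.
move=> c2 pimn mono r0 BK SB e10 Te hessle h0 hr Th.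
have r60 : 0 < 6 * r by rewrite mulr_gt0.
have [t [TE t01 I [Wm Wn] [Dm Dn]]] := smallness_bounds r60 Te.
have tw : ((t * (6 * r) ^+ (d + 2))%:E < (h ^+ (d + 2) / 8)%:E)%E.
  move: Th; rewrite TE !lte_fin invfM mulrA ltr_pdivlMr// exprn_gt0//.
have [k1 k1E k12] := density_defect_half (density_ge0 mu _) e10 Dm.
have [k2 k2E k22] := density_defect_half (density_ge0 nu _) e10 Dn.
have h1 : h <= (d.+1)%:R * h by rewrite ler_peMl ?ler1n// ltW.
have tri (a b : E) : enorm a <= enorm b + enorm (a - b).
  by rewrite -{1}(subrKC b a) ler_enormD.
have distC (a b : E) : enorm (a - b) = enorm (b - a).
  by rewrite -enormN opprB.
have pr (p : E) : enorm p <= 5 * r -> ball p (2 * h) `<=` eball (6 * r).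
  move=> p5 x /(ball_sub_enorm h0); rewrite /eball/= -mulrA => xp.
  by have := tri x p; lra.
have test1 p : enorm p <= 5 * r ->
    exists z, [/\ Spt pi z, ball p (2 * h) z.1 & enorm (z.1 - z.2) < h].
  move=> p5; apply: (test_point (f := fst) (m := mu) (k := k1) (r := 6 * r)) => //.
  - by move=> A mA; have [] := pimn A mA.
  - by move=> z z6; left.
  - exact: le_lt_trans Wm tw.
  - exact: le_lt_trans I tw.
  - exact: pr.
have test2 p : enorm p <= 5 * r ->
    exists z, [/\ Spt pi z, ball p (2 * h) z.2 & enorm (z.1 - z.2) < h].
  move=> p5; apply: (test_point (f := snd) (m := nu) (k := k2) (r := 6 * r)) => //.
  - by move=> A mA; have [] := pimn A mA.
  - by move=> z z6; right.
  - exact: le_lt_trans Wn tw.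
  - exact: le_lt_trans I tw.
  - exact: pr.
(* A test point near p has both components of norm between 9/2 r and 5 r;
   it lies in the cross, hence in the biball, so L r exceeds one of the norms. *)
have L92 : 9 / 2 * r < L * r.
  pose p : E := (19 / 4 * r) *: delta_mx 0 j.
  have pn : enorm p = 19 / 4 * r.
    by rewrite enormZ enorm_delta mulr1 ger0_norm// mulr_ge0 ?divr_ge0// ltW.
  have [|[a b] [Sab /(ball_sub_enorm h0) /= pa ab]] := test1 p.
    by rewrite pn; lra.
  rewrite -mulrA in pa.
  have pa1 := tri p a; have ap := tri a p; have ab1 := tri a b; have ba := tri b a.
  rewrite (distC b a) (distC p a) pn in pa1 ap ba.
  have : biball (5 * r) (L * r) (a, b).
    by apply: SB; split => //; left; split => //=; rewrite /eball/=; lra.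
  by rewrite /biball/eball/= => -[] [? ?]; lra.
have hess_le z : biball (5 * r) (L * r) z -> enorm (hess_xy c z + 1%:M) <= e.
  move=> Bz; rewrite -lee_fin; apply: le_trans hessle.
  by apply: ereal_sup_ubound; exists z.
have seg5 (a b : E) (s : R) : 0 <= s <= 1 -> eball (5 * r) a -> eball (5 * r) b ->
  eball (5 * r) (b + s *: (a - b)) by move=> s01 ar br; exact: eball_segment.
have segL (a b : E) (s : R) : 0 <= s <= 1 -> eball (L * r) a -> eball (L * r) b ->
  eball (L * r) (b + s *: (a - b)) by move=> s01 ar br; exact: eball_segment.
have small (a : E) : enorm a < 9 / 2 * r -> eball (5 * r) a /\ eball (L * r) a.
  by move=> a9; rewrite /eball/=; split; lra.
(* Since 9/2 < L, the points x' and y' lie in both balls, so the rectangle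
   stays in whichever half of the biball contains (x, y). *)
have mon x y x' y' : Spt pi (x, y) -> Spt pi (x', y') ->
    enorm x < 4 * r \/ enorm y < 4 * r ->
    enorm x' < 9 / 2 * r -> enorm y' < 9 / 2 * r ->
    - (e * enorm (x - x') * enorm (y - y')) <= frob (x - x') (y - y').
  move=> Sxy Sxy' xy4 /small[x5 xL] /small[y5 yL].
  apply: (c_monotone_frob c2 BK hess_le); last exact: mono.
  have : biball (5 * r) (L * r) (x, y).
    apply: SB; split => //.
    by case: xy4 => H; [left|right]; split=> //; rewrite /eball/=; lra.
  move=> [[/= X5 YL]|[/= XL Y5]] s u s01 u01; [left|right]; split => /=; auto.
move=> x y [[[/= x4 _]|[/= _ y4]] Sxy].
  apply: (displacement_bound h0 hr e10 test1 _ Sxy x4).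
  by move=> a b a' b' Sab Sab' a4; apply: mon => //; left.
(* The case of y in the small ball is the previous one for the transposed
   support. *)
rewrite distC.
apply: (@displacement_bound _ _ [set z | Spt pi (z.2, z.1)] r h e) => //.
  move=> p /test2[[a b] [Sab pb ab]]; exists (b, a); split => //=.
  by rewrite distC.
move=> b a b' a' /= Sab Sab' b4 b'9 a'9.
rewrite frobC mulrAC; apply: mon => //; by right.
Qed.

End displacement_at_scale.

Theorem proposition1p5 (R : realType) (d : nat) :
  exists eps C : R, 0 < eps /\
  forall (X Y : set 'rV[R]_d) (c : 'rV[R]_d * 'rV[R]_d -> R)
    (mu nu : {measure set 'rV[R]_d -> \bar R})
    (pi : {measure set ('rV[R]_d * 'rV[R]_d) -> \bar R}),
  compact X -> compact Y ->
  C2_near (X `*` Y) c ->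
  (forall x, X x -> set_inj Y (fun y => - grad_x c (x, y))) ->
  (forall y, Y y -> set_inj X (fun x => - grad_y c (x, y))) ->
  (forall z, (X `*` Y) z -> \det (hess_xy c z) != 0) ->
  couplings mu nu pi ->
  Spt pi `<=` X `*` Y ->
  c_monotone c (Spt pi) ->
  forall Lambda r : R, 0 < r ->
  biball (5 * r) (Lambda * r) `<=` X `*` Y ->
  cross (5 * r) `&` Spt pi `<=` biball (5 * r) (Lambda * r) ->
  (local_energy (6 * r) pi + data_defect (6 * r) mu nu <= eps%:E)%E ->
  (C0norm (fun z => (hess_xy c z + 1%:M)%R)
     (biball (5 * r) (Lambda * r)) <= eps%:E)%E ->
  forall x y : 'rV[R]_d, (cross (4 * r) `&` Spt pi) (x, y) ->
  ((enorm (x - y))%:E <= (C * r)%:E *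
     (local_energy (6 * r) pi + data_defect (6 * r) mu nu) `^ ((d + 2)%:R^-1))%E.
Proof.
(* The scale is h = eta r. It must satisfy (d + 1) h <= r / 80, whence eta0, and
   h^(d+2) > 8 t (6 r)^(d+2), for which eta > 48 s with s = t^(1/(d+2)) suffices
   since 8 * 6^(d+2) <= 48^(d+2). The choice of eps gives 48 s <= eta0 / 2. *)
pose eta0 : R := (80 * d.+1%:R)^-1.
have eta00 : 0 < eta0 by rewrite invr_gt0 mulr_gt0.
pose eps : R := Num.min (1 / 10) ((eta0 / 96) ^+ (d + 2)).
exists eps, (48 * (32 * d.+1%:R)); split.
  by rewrite lt_min divr_gt0//= exprn_gt0// divr_gt0.
move=> X Y c mu nu pi _ _ c2 _ _ _ pimn _ mono L r r0 BK SB Te hess x y Sxy.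
have e10 : eps <= 1 / 10 by rewrite ge_min lexx.
have [t [TE /andP[t0 te] _ _ _]] := smallness_bounds (mulr_gt0 (ltr0n _ 6) r0) Te.
rewrite TE poweR_EFin -EFinM lee_fin.
set s := t `^ _.
have s0 : 0 <= s by exact: powR_ge0.
have sE : s ^+ (d + 2) = t.
  by rewrite -powR_mulrn// -powRrM mulVf ?powRr1// pnatr_eq0 addn2.
have sle : s <= eta0 / 96.
  rewrite -(@ler_pXn2r _ (d + 2)) ?nnegrE ?addn2//; last by rewrite divr_ge0// ltW.
  by rewrite -addn2 sE (le_trans te)// ge_min lexx orbT.
case: (posnP d) => [d0|dgt0].
  have : enorm (x - y) <= d%:R * 0.
    by apply: enorm_le_coord => // -[k kd]; exfalso; rewrite d0 in kd.
  rewrite mulr0 => /le_trans; apply.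
  by apply: mulr_ge0 => //; apply: mulr_ge0; [by rewrite !mulr_ge0|exact: ltW].
have H eta : 48 * s < eta -> eta <= eta0 ->
    enorm (x - y) <= 32 * d.+1%:R * (eta * r).
  move=> seta etale.
  have eta_gt0 : 0 < eta by apply: le_lt_trans seta; rewrite mulr_ge0.
  apply: (displacement_at_scale (Ordinal dgt0) c2 pimn mono r0 BK SB e10 Te hess) => //.
  - exact: mulr_gt0.
  - rewrite mulrA [_ / 80]mulrC ler_pM2r//.
    apply: (@le_trans _ _ (d.+1%:R * eta0)); first by rewrite ler_pM2l.
    by rewrite /eta0 invfM mulrCA mulfV ?mulr1.
  - rewrite TE lte_fin !exprMn mulrA -mulf_div divff ?mulr1; last first.
      by rewrite gt_eqF// exprn_gt0.
    rewrite ltr_pdivlMr ?mulr_gt0 ?exprn_gt0// -sE.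
    apply: le_lt_trans (_ : (48 * s) ^+ (d + 2) < _); last first.
      by rewrite ltrXn2r ?nnegrE ?mulr_ge0 ?addn2// ltW.
    rewrite exprMn mulrC ler_wpM2r ?exprn_ge0//.
    have -> : 48 = 8 * 6 :> R by rewrite -natrM.
    rewrite exprMn ler_pM2r ?exprn_gt0// addn2 exprS ler_peMr//.
    by rewrite exprn_ege1// ler1n.
(* Otherwise some admissible eta lies strictly between 48 s and the value
   |x - y| / K at which the bound would be attained. *)
rewrite leNgt; apply/negP => xy.
pose K := 32 * d.+1%:R * r.
have K0 : 0 < K by rewrite !mulr_gt0.
have xyK : 48 * s < enorm (x - y) / K.
  rewrite ltr_pdivlMr//; apply: le_lt_trans xy; rewrite /K; lra.
pose eta := Num.min eta0 ((48 * s + enorm (x - y) / K) / 2).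
have seta : 48 * s < eta by rewrite lt_min; apply/andP; split; lra.
have etale : eta <= eta0 by rewrite ge_min lexx.
have : enorm (x - y) <= K * eta.
  by apply: le_trans (H _ seta etale) _; rewrite /K; lra.
rewrite -ler_pdivrMl// mulrC => xyeta.
have etale2 : eta <= (48 * s + enorm (x - y) / K) / 2 by rewrite ge_min lexx orbT.
lra.
Qed.
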